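(* Let $m\ge1$ be an integer, $a_m$ a real constant, $r\in\{0,1,\dots,m\}$, and consider the first-order time-marching finite-difference scheme $$u(x,\Delta t)=\sum_{k=-r}^{m-r}c_k\,u(x+k\Delta x,0),\qquad c_0=1+(-1)^m(-1)^rC_r^m\nu_m,\qquad c_k=(-1)^m(-1)^{r+k}C_{r+k}^m\nu_m\ \ (k\ne0),$$ for solving the equation $\dfrac{\partial u}{\partial t}=a_m\partial_x^m u$, where $\nu_m=\Delta t\,a_m/\Delta x^m$. If the scheme is von Neumann stable, then its range of stability is limited to $$|\nu_m|\le\frac{1}{2^{m-1}}.$$ That is, if the scheme is von Neumann stable at the value $\nu_m$, then $|\nu_m|\le 2^{-(m-1)}$.
   Context: $\Delta t,\Delta x>0$ are the time step and grid spacing, and $C_k^m=\frac{m!}{k!(m-k)!}$. The amplification factor of the scheme for a Fourier mode $e^{ipx}$, with $\theta=p\Delta x$, is $g(\theta)=\sum_{k=-r}^{m-r}c_k e^{ik\theta}$. The scheme is von Neumann stable at a given value of $\nu_m$ if $|g(\theta)|\le1$ for all $\theta\in[0,2\pi]$. *)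

(* Defs.v *)
From HB Require Import structures.
From mathcomp Require Import all_boot all_order all_algebra.
From mathcomp Require Import all_classical all_reals all_analysis.
From mathcomp Require Import complex.

Set Implicit Arguments.
Unset Strict Implicit.
Unset Printing Implicit Defensive.

Import Order.TTheory GRing.Theory Num.Theory.
Local Open Scope ring_scope.
Local Open Scope complex_scope.

(* The explicit one-step scheme
     u(x, dt) = \sum_(-lwidth s <= k <= rwidth s) coef s k * u(x + k dx, 0);
   values of [coef s] outside that range of k are never used. *)
Record fd_scheme (R : realType) := FDScheme {
  lwidth : nat;
  rwidth : nat;
  coef : int -> R }.

(* e^{it} *)
Definition expi (R : realType) (t : R) : R[i] := cos t +i* sin t.

(* The integer index k runs over -lwidth s, ..., rwidth s as k = j - lwidth s
   with 0 <= j <= lwidth s + rwidth s. *)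
Definition step (R : realType) (s : fd_scheme R) (dx : R) (u : R -> R[i])
    (x : R) : R[i] :=
  \sum_(j < (lwidth s + rwidth s).+1)
    let k : int := j%:Z - (lwidth s)%:Z in
    (coef s k)%:C * u (x + k%:~R * dx).

Definition amplification (R : realType) (s : fd_scheme R) (t : R) : R[i] :=
  \sum_(j < (lwidth s + rwidth s).+1)
    let k : int := j%:Z - (lwidth s)%:Z in
    (coef s k)%:C * expi (k%:~R * t).

(* The order on R[i] is partial, but both sides here are real, so this is the
   usual comparison of the modulus with 1. *)
Definition von_neumann_stable (R : realType) (s : fd_scheme R) : Prop :=
  forall t : R, 0 <= t <= 2 * pi -> `|amplification s t| <= 1.

Lemma expiD (R : realType) (s t : R) : expi (s + t) = expi s * expi t.
Proof.
rewrite /expi cosD sinD; apply/eqP; rewrite eq_complex /= eqxx /=.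
by rewrite addrC.
Qed.

Lemma step_fourier_mode (R : realType) (s : fd_scheme R) (dx p x : R) :
  step s dx (fun y => expi (p * y)) x
  = amplification s (p * dx) * expi (p * x).
Proof.
rewrite /step /amplification mulr_suml; apply: eq_bigr => j _ /=.
by rewrite mulrDr expiD (mulrCA p) -mulrA [expi (p * x) * _]mulrC.
Qed.

(* absz (r + k) equals r + k for every k in
   the range -r <= k <= m - r that the scheme uses. *)
Definition time_marching_coef (R : realType) (m r : nat) (nu : R) (k : int) :
    R :=
  if k == 0 then 1 + (-1) ^+ m * (-1) ^+ r * 'C(m, r)%:R * nu
  else (-1) ^+ m * (-1) ^ (r%:Z + k) * 'C(m, absz (r%:Z + k))%:R * nu.

Definition time_marching_scheme (R : realType) (m r : nat) (nu : R) :
    fd_scheme R :=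
  FDScheme r (m - r)%N (time_marching_coef m r nu).

(* Main.v *)
Require Import Defs.
From HB Require Import structures.
From mathcomp Require Import all_boot all_order all_algebra.
From mathcomp Require Import all_classical all_reals all_analysis.
From mathcomp Require Import complex.
From mathcomp Require Import ring.

Set Implicit Arguments.
Unset Strict Implicit.
Unset Printing Implicit Defensive.

Import Order.TTheory GRing.Theory Num.Theory.
Local Open Scope ring_scope.

(* At t = pi every factor expi (k t) is (-1) ^ k and cancels the alternating
   sign of c_k, so the binomial coefficients add up to 2 ^ m: the amplification
   factor there is 1 +- 2 ^ m nu, and modulus at most 1 forces
   2 ^ m |nu| <= 2. *)

(** Shifting the index to [j = r + k] removes the integer exponent and the [absz], and turns the
    case split at [k = 0] into a Kronecker term. *)
Lemma time_marching_coefE (R : realType) (m r j : nat) (nu : R) :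
  time_marching_coef m r nu (j%:Z - r%:Z) =
  (j == r)%:R + (-1) ^+ m * (-1) ^+ j * 'C(m, j)%:R * nu.
Proof.
rewrite /time_marching_coef subr_eq0 eqz_nat.
case: eqP => [->|_] /=; first by [].
by rewrite addrCA subrr addr0 add0r.
Qed.

Lemma expi_natpi (R : realType) (n : nat) :
  expi (n%:R * pi : R) = ((-1) ^+ n)%:C%C.
Proof.
elim: n => [|n IHn]; first by rewrite mul0r expr0 /expi cos0 sin0.
rewrite -natr1 mulrDl mul1r expiD IHn exprSr rmorphM /=; congr (_ * _).
by rewrite /expi cospi sinpi.
Qed.

Lemma expi_subnpi (R : realType) (j r : nat) :
  expi ((j%:Z - r%:Z)%:~R * pi : R) = ((-1) ^+ j * (-1) ^+ r)%:C%C.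
Proof.
have := expi_natpi R j.
(* Split [j = (j - r) + r]; the factor [(-1) ^+ r] coming from [r] is its own inverse, so it can be
   moved across. *)
rewrite -{1}[j%:R](subrK (r%:R : R)) mulrDl expiD expi_natpi rmorphB /=.
by rewrite rmorphM /= => <-; rewrite -mulrA -rmorphM -expr2 sqrr_sign mulr1.
Qed.

Lemma amplification_pi (R : realType) (m r : nat) (nu : R) : (r <= m)%N ->
  amplification (time_marching_scheme m r nu) pi =
  (1 + (-1) ^+ m * (-1) ^+ r * 2 ^+ m * nu)%:C%C.
Proof.
move=> hr; rewrite /amplification /= subnKC //.
(* The real value of the [j]-th summand at [pi]: the two signs [(-1) ^+ j] have cancelled, and only
   the [(-1) ^+ r] of the index shift is left. *)
pose F (j : 'I_m.+1) : R :=
  (j == r :> nat)%:R + (-1) ^+ m * (-1) ^+ r * nu * 'C(m, j)%:R.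
transitivity ((\sum_j F j)%:C)%C.
  rewrite rmorph_sum; apply: eq_bigr => j _.
  rewrite time_marching_coefE expi_subnpi -rmorphM /F; congr (_%:C)%C.
  rewrite mulrDl; congr (_ + _).
    case: eqP => [->|_]; last by rewrite !mul0r.
    by rewrite mul1r -expr2 sqrr_sign.
  transitivity (((-1) ^+ j * (-1) ^+ j) *
      ((-1) ^+ m * (-1) ^+ r * nu * 'C(m, j)%:R) : R); first by ring.
  by rewrite -expr2 sqrr_sign mul1r.
congr (_%:C)%C; rewrite big_split /= -mulr_sumr; congr (_ + _).
  (* The Kronecker terms add up to 1, since [r <= m] makes [r] one of the indices. *)
  rewrite (bigD1 (Ordinal (hr : (r < m.+1)%N))) //= eqxx big1 ?addr0 //.
  by move=> i; rewrite -val_eqE /= => /negbTE ->.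
have sum_bin : (\sum_(i < m.+1) 'C(m, i) = 2 ^ m)%N.
  by rewrite (expnDn 1 1 m); apply: eq_bigr => i _; rewrite !exp1n !muln1.
by rewrite -natr_sum sum_bin natrX; ring.
Qed.

Theorem theorem5 (R : realType) (m r : nat) (a dt dx : R)
    (hm : (1 <= m)%N) (hr : (r <= m)%N) (hdt : 0 < dt) (hdx : 0 < dx) :
  let nu := dt * a / dx ^+ m in
  von_neumann_stable (time_marching_scheme m r nu) ->
  `|nu| <= 1 / 2 ^+ (m - 1)%N.
Proof.
move=> nu; clearbody nu => stable.
have pi_range : 0 <= (pi : R) <= 2 * pi by rewrite pi_ge0 ler_peMl ?pi_ge0 ?ler1n.
have := stable pi pi_range; rewrite amplification_pi // normc_def /=.
rewrite expr0n addr0 sqrtr_sqr lecR => le1.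
have : `|(-1) ^+ m * (-1) ^+ r * 2 ^+ m * nu| <= 2.
  (* Triangle inequality on [X = -1 + (1 + X)], where [1 + X] is the amplification factor. *)
  rewrite -[X in `|X|](addKr 1) (le_trans (ler_normD _ _)) //.
  by rewrite normrN normr1 -[leRHS]/(1 + 1) lerD2l.
rewrite !normrM !normr_sign !mul1r normrX ger0_norm // => le2.
(* Doubling both sides raises [2 ^+ (m - 1)] to [2 ^+ m]; [1 <= m] keeps the natural subtraction
   from truncating. *)
rewrite -div1r ler_pdivlMr ?exprn_gt0 // -(@ler_pM2r _ 2) // mul1r -mulrA -exprSr.
by rewrite subn1 prednK // mulrC.
Qed.
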